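(* Let $a=(a_1,\ldots,a_n)\in\mathbb{Z}^n$ and $e=(e_1,\ldots,e_n)\in\mathbb{N}^n$, and let $\mathcal{A}_{\mathbb{Z}}$ be the set of words that contain exactly $e_j$ copies of $a_j$ for each $1\le j\le n$ (and no other letters). Then the sweep map $\mathsf{sweep}:\mathcal{A}_{\mathbb{Z}}\to\mathcal{A}_{\mathbb{Z}}$ is a bijection.
   Context: For a word $\mathsf{w}=\mathsf{w}_1\cdots\mathsf{w}_N\in\mathcal{A}_{\mathbb{Z}}$, the level of $\mathsf{w}_j$ is the integer $\ell_j:=\sum_{i=1}^{j}\mathsf{w}_i$. The sweep map is defined as follows: start with the empty word $\mathsf{u}$; for $k=-1,-2,-3,\ldots$ (all negative integers in decreasing order) and then for the nonnegative integers $k$ in decreasing order ending with $\ldots,3,2,1,0$, read $\mathsf{w}$ from right to left and append to $\mathsf{u}$ each letter $\mathsf{w}_j$ with $\ell_j=k$. Set $\mathsf{sweep}(\mathsf{w}):=\mathsf{u}$ (only finitely many $k$ contribute). *)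

(* Defs.v *)
From mathcomp Require Import all_boot all_order all_algebra.
From mathcomp Require Import classical_sets functions.

Set Implicit Arguments.
Unset Strict Implicit.
Unset Printing Implicit Defensive.

Import Order.TTheory GRing.Theory Num.Theory.
Local Open Scope ring_scope.

Definition words (n : nat) (a : 'I_n -> int) (e : 'I_n -> nat) :
    set (seq int) :=
  [set w | (forall j, count_mem (a j) w = e j) /\ {subset w <= codom a}]%classic.

(* Positions are numbered from 0, so [level w j] is the sum of the letters up
   to and including the one at position j, i.e. the paper's l_(j+1). *)
Definition level (w : seq int) (j : nat) : int := \sum_(i < j.+1) w`_i.

Definition letters_at_level (w : seq int) (k : int) : seq int :=
  [seq w`_j | j <- rev (iota 0 (size w)) & level w j == k].

(* -1, -2, ..., -M, M, ..., 2, 1, 0 *)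
Definition scan_order (M : nat) : seq int :=
  [seq - k%:Z | k <- iota 1 M] ++ [seq k%:Z | k <- rev (iota 0 M.+1)].

Definition sweep_upto (M : nat) (w : seq int) : seq int :=
  flatten [seq letters_at_level w k | k <- scan_order M].

Definition level_bound (w : seq int) : nat := (\sum_(x <- w) `|x|)%N.

(* The scan over all integers is truncated at [level_bound w]; by
   [sweep_uptoE], every larger truncation gives the same word. *)
Definition sweep (w : seq int) : seq int := sweep_upto (level_bound w) w.

Lemma level_le_bound (w : seq int) (j : nat) :
  (j < size w)%N -> (`|level w j| <= level_bound w)%N.
Proof.
move=> ltj; apply: (@leq_trans (\sum_(i < j.+1) `|(w`_i)%R|)%N).
  rewrite /level; elim/big_ind2: _ => // m x p y le_xm le_yp.
  rewrite -lez_nat abszE (le_trans (ler_normD x y)) //.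
  by rewrite PoszD lerD // -abszE lez_nat.
rewrite /level_bound [leqRHS](big_nth 0) big_mkord.
rewrite (big_ord_widen _ (fun i => `|(w`_i)%R|%N) ltj).
by rewrite [leqRHS](bigID (fun i : 'I__ => (i < j.+1)%N)) /= leq_addr.
Qed.

Lemma sweep_uptoE (w : seq int) (M : nat) :
  (level_bound w <= M)%N -> sweep_upto M w = sweep w.
Proof.
have empty (k : int) : (level_bound w < `|k|)%N -> letters_at_level w k = [::].
  move=> ltk; rewrite /letters_at_level (@eq_in_filter _ _ pred0).
    by rewrite filter_pred0.
  move=> j; rewrite mem_rev mem_iota /= add0n => ltj.
  apply/eqP => lvl; have := level_le_bound ltj.
  by rewrite lvl leqNgt ltk.
move=> /subnK <-; elim: (M - _)%N => [//|d IHd].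
rewrite -{}IHd addSn; set m := (d + _)%N.
have ltm : (level_bound w < m.+1)%N by rewrite ltnS leq_addl.
have iotaSr i n : iota i n.+1 = rcons (iota i n) (i + n)%N.
  by rewrite -cats1 -[n.+1]addn1 iotaD.
rewrite /sweep_upto /scan_order iotaSr [iota 0 m.+2]iotaSr rev_rcons.
rewrite map_cons map_rcons add1n add0n -cats1 -catA /= !map_cat !flatten_cat /=.
by rewrite !empty ?abszN.
Qed.

(* Main.v *)
Require Import Defs.
From mathcomp Require Import all_boot all_order all_algebra.
From mathcomp Require Import classical_sets functions.
From mathcomp Require Import zify.

(** The words are the permutations of one word and the sweep map permutes
letters, so injectivity suffices.  If all levels lie in [-M, M] and
m = 2M + 1, the scan order -1, ..., -M, M, ..., 0 lists the residues mod m in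
decreasing order.  Suppose w and w' have the same image u, and let the p-th
letter u_p have residual level lam(p) in w and mu(p) in w'; it is a step from
its tail lam(p) - u_p to its head lam(p) on the cycle Z/m.  Move every step
from its w-position to its w'-position.  Both words walk from 0 to the same
end point, so heads and tails have the same net flow through every edge
(k - 1, k) of the cycle.  As lam and mu are weakly decreasing, the heads
crossing a given edge all cross it in the same direction; as the total
distance travelled by heads and tails is the same, so do the tails.  Now let p
be the first letter of w, in the order of time, with mu(p) < lam(p), and k its
tail.  Then heads also flow down through the edge below k, so k <> 0 and the
last letter of u with lam >= k has mu < k.  But the step reaching k just
before p has head k and is not moved down, although within a level the letters
of u appear in reverse order of time: a contradiction.  Hence lam <= mu, by
symmetry lam = mu, and u together with lam determines w. *)

Set Implicit Arguments.
Unset Strict Implicit.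
Unset Printing Implicit Defensive.

Import Order.TTheory GRing.Theory Num.Theory.
Local Open Scope ring_scope.

(** * Counting crossings on the cycle of residues *)

(* The signed number of integers congruent to k mod m passed when going from x
   to y: an integer is passed when it lies in ]x, y]. *)
Definition crossings (m k x y : int) : int :=
  ((y - k) %/ m)%Z - ((x - k) %/ m)%Z.

(** A form of Hermite's identity: raising [x] by 1 shifts the summands cyclically, and the one that
    wraps around gains 1. *)
Lemma sum_divz_shift (m : nat) (x : int) : (0 < m)%N ->
  \sum_(k < m) ((x - k%:Z) %/ m)%Z = x + 1 - m%:Z.
Proof.
move=> m_gt0; have m_neq0 : m%:Z != 0 by lia.
pose S y := \sum_(k < m) ((y - k%:Z) %/ m)%Z.
have S_succ y : S (y + 1) = S y + 1.
  rewrite /S; case: m m_gt0 m_neq0 @S => // m _ m_neq0 _.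
  rewrite big_ord_recl big_ord_recr /= subr0.
  have -> : ((y + 1) %/ m.+1%:Z)%Z = 1 + ((y - m%:Z) %/ m.+1%:Z)%Z.
    by rewrite -divzMDl //; congr divz; lia.
  rewrite -addrA addrC [_ + \sum_(i < m) _]addrC; congr (_ + _ + _).
  by apply: eq_bigr => i _; congr divz; rewrite /bump /=; lia.
have S0 : S 0 = 1 - m%:Z.
  rewrite /S; case: m m_gt0 m_neq0 @S S_succ => // m _ _ _ _.
  rewrite big_ord_recl /= (eq_bigr (fun=> -1)) => [|i _]; last first.
    have -> : 0 - (lift ord0 i)%:Z = -1 * m.+1%:Z + (m - i)%N%:Z.
      by have := ltn_ord i; rewrite /= /bump /=; lia.
    by rewrite divzMDl // divz_small //; lia.
  by rewrite sumr_const card_ord mulNrn natz divz_small; lia.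
rewrite -/(S x); case: x => n.
  elim: n => [|n IHn]; first by rewrite S0; lia.
  by rewrite -addn1 PoszD S_succ IHn; lia.
elim: n => [|n IHn].
  have := S_succ (Negz 0); have -> : Negz 0 + 1 = 0 by lia.
  by rewrite S0; lia.
have := S_succ (Negz n.+1).
have -> : Negz n.+1 + 1 = Negz n by lia.
by rewrite IHn; lia.
Qed.

(** All crossings have the same sign, and each integer passed is congruent to exactly one
    [k < m]. *)
Lemma sum_norm_crossings (m : nat) (x y : int) : (0 < m)%N ->
  \sum_(k < m) `|crossings m k x y| = `|y - x|.
Proof.
move=> m_gt0.
have sum_le x' y' : x' <= y' ->
    \sum_(k < m) `|crossings m k x' y'| = `|y' - x'|.
  move=> le_xy; rewrite (eq_bigr (fun k : 'I_m => crossings m k x' y')).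
    by rewrite sumrB !sum_divz_shift //; lia.
  move=> k _; apply: ger0_norm; rewrite subr_ge0; apply: lez_pdiv2r; lia.
case/orP: (le_total x y) => [/sum_le // | /sum_le]; rewrite distrC => <-.
by apply: eq_bigr => k _; rewrite /crossings distrC.
Qed.

(** Inside the window [[0, m)] the only integer congruent to [k] is [k] itself. *)
Lemma crossing_window (m k x y : int) : 0 <= k < m -> 0 <= x < m ->
    0 <= y < m ->
  crossings m k x y = (k <= y)%R%:Z - (k <= x)%R%:Z.
Proof.
move=> k_m x_m y_m.
have div_window z : 0 <= z < m -> ((z - k) %/ m)%Z = (k <= z)%R%:Z - 1.
  move=> z_m; case: (lerP k z) => [le_kz | lt_zk].
    by rewrite divz_small //; lia.
  have -> : z - k = -1 * m + (z - k + m) by lia.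
  by rewrite divzMDl ?divz_small //; lia.
by rewrite /crossings !div_window //; lia.
Qed.

Lemma crossings_le0 (m k x y : int) : 0 < m -> y <= x -> crossings m k x y <= 0.
Proof. by move=> m_gt0 le_yx; rewrite subr_le0; apply: lez_pdiv2r; lia. Qed.

(** * Comparing two walks on the cycle *)

(* [t p] is the time at which the walk with levels [lam] takes the letter [u p];
   the last hypothesis says that it starts at 0. *)
Lemma walk_le (m N : nat) (u lam mu : 'I_N -> int) (t : 'I_N -> nat) :
    (0 < m)%N ->
    (forall p, 0 <= lam p < m%:Z) -> (forall p, 0 <= mu p < m%:Z) ->
    (forall p q : 'I_N, (p <= q)%N -> lam q <= lam p) ->
    (forall p q : 'I_N, (p <= q)%N -> mu q <= mu p) ->
    (forall k : int,
      \sum_p (((lam p - k) %% m)%Z - ((lam p - u p - k) %% m)%Z) =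
      \sum_p (((mu p - k) %% m)%Z - ((mu p - u p - k) %% m)%Z)) ->
    (forall p q : 'I_N, (p < q)%N -> lam p = lam q -> (t q < t p)%N) ->
    (forall p, ((lam p - u p) %% m)%Z = 0 \/
      exists2 q, (t q < t p)%N & lam q = ((lam p - u p) %% m)%Z) ->
  forall p, lam p <= mu p.
Proof.
move=> m_gt0 lam_m mu_m lam_anti mu_anti balance t_anti t_pred.
have m_neq0 : m%:Z != 0 by lia.
pose head k p := crossings m k (lam p) (mu p).
pose tail k p := crossings m k (lam p - u p) (mu p - u p).
(* Multiplying by [m] turns quotients into residues; the displacement [mu p - lam p] is common to
   head and tail and cancels, leaving [balance]. *)
have head_tail k : \sum_p head k p = \sum_p tail k p.
  apply: (mulIf m_neq0); rewrite !mulr_suml.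
  apply/eqP; rewrite -subr_eq0 -sumrB; apply/eqP.
  move/eqP: (balance k); rewrite -subr_eq0 -sumrB => /eqP {2}<-.
  apply: eq_bigr => p _; rewrite /head /tail /crossings /modz; lia.
(* [sg k] is the direction in which the heads cross edge k. *)
pose down (k : 'I_m) := [exists p, head k p < 0].
pose sg (k : 'I_m) : int := if down k then -1 else 1.
have headE (k : 'I_m) p : head k p = (k%:Z <= mu p)%R%:Z - (k%:Z <= lam p)%R%:Z.
  by apply: crossing_window => //; have := ltn_ord k; lia.
have head_sg (k : 'I_m) p : sg k * head k p = `|head k p|.
  rewrite /sg; case: ifPn => [/existsP[q q_down]|].
    suff : head k p <= 0 by lia.
    move: q_down; rewrite !headE => q_down.
    (* As [q] crosses down, [k <= lam p] for [p] up to [q] and [mu p < k] for [p] from [q] on, so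
       [p] cannot cross up. *)
    case: (leqP p q) => [le_pq | /ltnW le_qp].
      by have := lam_anti _ _ le_pq; lia.
    by have := mu_anti _ _ le_qp; lia.
  by rewrite negb_exists => /forallP/(_ p); lia.
have tail_sg (k : 'I_m) p : `|tail k p| - sg k * tail k p = 0.
  have tail_ge0 (k' : 'I_m) p' : 0 <= `|tail k' p'| - sg k' * tail k' p'.
    by rewrite /sg; case: ifP => _; lia.
  (* By [head_tail] the signed tails add up to the distance travelled by the heads, which is also
     that travelled by the tails. *)
  have total : \sum_(k < m) \sum_p (`|tail k p| - sg k * tail k p) = 0.
    rewrite (eq_bigr (fun k : 'I_m => \sum_p (`|tail k p| - `|head k p|))).
      rewrite exchange_big big1 //= => p' _.
      rewrite sumrB !sum_norm_crossings //; lia.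
    move=> k' _; rewrite !sumrB -mulr_sumr -head_tail mulr_sumr.
    by congr (_ - _); apply: eq_bigr => p' _; rewrite head_sg.
  have total_k : \sum_p (`|tail k p| - sg k * tail k p) = 0.
    by apply: (psumr_eq0P _ total) => // k' _; apply: sumr_ge0.
  by apply: (psumr_eq0P _ total_k).
move=> p; have [n] := ubnP (t p); elim: n p => // n IHn p.
rewrite ltnS => le_tp; case: lerP => // p_bad; exfalso.
pose k := ((lam p - u p) %% m)%Z.
have k_ge0 : 0 <= k by apply: modz_ge0.
have k_m : (`|k| < m)%N by have := ltz_pmod (lam p - u p) (m_gt0 : 0 < m%:Z); lia.
pose ko := Ordinal k_m.
have koE : ko%:Z = k by rewrite /=; lia.
(* The tail starts at an integer congruent to [k], which any move down passes. *)
have tail_down : tail ko p < 0.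
  rewrite /tail koE /crossings subr_lt0.
  have -> : lam p - u p - k = ((lam p - u p) %/ m)%Z * m.
    by rewrite {1}(divz_eq (lam p - u p) m) -/k addrK.
  by rewrite mulzK // ltz_divLR //; lia.
have : down ko.
  by have := tail_sg ko p; rewrite /sg; case: ifP => // _; lia.
case/existsP => r; rewrite headE koE => r_down.
have r_bad : mu r < k <= lam r by lia.
have [k0 | [q lt_tq q_k]] := t_pred p; first by have := mu_m r; lia.
have q_good : lam q <= mu q by apply: IHn; lia.
rewrite -/k in q_k.
(* Up to [q], such an [r] forces [mu q < k]. After [q], it has head [k], so it is earlier than [q]
   and by induction not moved down. *)
case: (leqP r q) => [le_rq | lt_qr].
  by have := mu_anti _ _ le_rq; lia.
have lam_r : lam q = lam r by have := lam_anti _ _ (ltnW lt_qr); lia.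
have := t_anti _ _ lt_qr lam_r => lt_tr.
have : lam r <= mu r by apply: IHn; lia.
lia.
Qed.

(** * The scan order modulo [M.*2.+1] and the order of positions *)

Lemma mem_scan_order (M : nat) (k : int) :
  (k \in scan_order M) = (`|k| <= M)%N.
Proof.
rewrite mem_cat; apply/orP/idP => [[/mapP[i]|/mapP[i]]|le_kM].
- by rewrite mem_iota => ? ->; lia.
- by rewrite mem_rev mem_iota => ? ->; lia.
case: (lerP 0 k) => k0; [right|left]; apply/mapP; exists `|k|%N; try lia.
- by rewrite mem_rev mem_iota; lia.
- by rewrite mem_iota; lia.
Qed.

(** The residues are 2M, ..., M+1 for the negative half, then M, ..., 0. *)
Lemma pairwise_scan_order (M : nat) :
  pairwise (fun k l : int => (l %% M.*2.+1)%Z < (k %% M.*2.+1)%Z)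
    (scan_order M).
Proof.
have ltn_tr : transitive ltn by apply: ltn_trans.
have gtn_tr : transitive (fun i j => j < i)%N by move=> ? ? ? /= ? ?; lia.
have neg_mod (i : nat) : (0 < i <= M)%N ->
    ((- i%:Z) %% M.*2.+1)%Z = (M.*2.+1 - i)%N%:Z.
  move=> i_M; have -> : - i%:Z = -1 * M.*2.+1%:Z + (M.*2.+1 - i)%N%:Z by lia.
  by rewrite modzMDl modz_small //; lia.
have pos_mod (i : nat) : (i <= M)%N -> (i%:Z %% M.*2.+1)%Z = i%:Z.
  by move=> i_M; rewrite modz_small //; lia.
rewrite pairwise_cat; apply/and3P; split.
- apply/allrelP => _ _ /mapP[i + ->] /mapP[j + ->].
  rewrite mem_iota mem_rev mem_iota => i_M j_M.
  by rewrite neg_mod ?pos_mod; lia.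
- rewrite pairwise_map; have := iota_ltn_sorted 1 M.
  rewrite sorted_pairwise //; apply: (@sub_in_pairwise _ [in iota 1 M]) => [i j|];
    last exact/allP.
  by rewrite !mem_iota /= => i_M j_M; rewrite !neg_mod; lia.
rewrite pairwise_map; have := iota_ltn_sorted 0 M.+1.
rewrite -[X in sorted _ X]revK rev_sorted sorted_pairwise //.
apply: (@sub_in_pairwise _ [in rev (iota 0 M.+1)]) => [i j|]; last exact/allP.
rewrite !mem_rev !mem_iota /= => i_M j_M.
by rewrite !pos_mod; lia.
Qed.

(** Positions, unlike letters, retain the level and the time of each step. *)
Definition sweep_order (M : nat) (w : seq int) : seq nat :=
  [seq j | k <- scan_order M,
           j <- [seq j <- rev (iota 0 (size w)) | level w j == k]].

Lemma sweep_upto_order (M : nat) (w : seq int) :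
  sweep_upto M w = [seq w`_j | j <- sweep_order M w].
Proof. by rewrite map_allpairs. Qed.

Lemma pairwise_sweep_order (M : nat) (w : seq int) :
  pairwise (fun i j : nat =>
    ((level w j %% M.*2.+1)%Z < (level w i %% M.*2.+1)%Z) ||
    ((level w i == level w j) && (j < i)%N)) (sweep_order M w).
Proof.
rewrite /sweep_order; have := pairwise_scan_order M.
elim: (scan_order M) => //= k ks IHks /andP[/allP k_ks /IHks pw_ks].
rewrite pairwise_cat pw_ks andbT map_id; apply/andP; split.
  apply/allrelP => i j; rewrite mem_filter => /andP[/eqP lvl_i _].
  case/allpairsPdep => l [j' [l_ks]].
  rewrite mem_filter => /andP[/eqP lvl_j _] ->.
  by rewrite lvl_i lvl_j k_ks.
have : pairwise (fun i j => j < i)%N (rev (iota 0 (size w))).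
  rewrite -sorted_pairwise => [|? ? ? /= ? ?]; last by lia.
  by rewrite rev_sorted iota_ltn_sorted.
move/(pairwise_filter (fun j => level w j == k)).
set block := filter _ _.
apply: (@sub_in_pairwise _ [in block]) => [i j|]; last exact/allP.
rewrite !mem_filter => /andP[/eqP -> _] /andP[/eqP -> _] /= ->.
by rewrite eqxx orbT.
Qed.

Lemma perm_sweep_order (M : nat) (w : seq int) : (level_bound w <= M)%N ->
  perm_eq (sweep_order M w) (iota 0 (size w)).
Proof.
move=> le_wM; apply: uniq_perm; rewrite ?iota_uniq //.
  by apply: pairwise_uniq (pairwise_sweep_order M w) => j; rewrite ltxx ltnn andbF.
move=> j; apply/allpairsPdep/idP => [[k [i [_]]]|j_w].
  by rewrite mem_filter mem_rev => /andP[_ ?] ->.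
exists (level w j), j; split; rewrite ?mem_filter ?eqxx ?mem_rev //.
rewrite mem_scan_order; apply: leq_trans le_wM; apply: level_le_bound.
by move: j_w; rewrite mem_iota.
Qed.

Lemma size_sweep_order (M : nat) (w : seq int) : (level_bound w <= M)%N ->
  size (sweep_order M w) = size w.
Proof. by move/perm_sweep_order/perm_size; rewrite size_iota. Qed.

Lemma perm_sweep_upto (M : nat) (w : seq int) : (level_bound w <= M)%N ->
  perm_eq (sweep_upto M w) w.
Proof.
move=> /perm_sweep_order w_ord; rewrite sweep_upto_order.
by rewrite (perm_trans (perm_map _ w_ord)) // -/(mkseq _ _) mkseq_nth.
Qed.

Lemma sum_nth_sweep_order (M : nat) (w : seq int) (G : nat -> int) :
    (level_bound w <= M)%N ->
  \sum_(p < size w) G (nth 0%N (sweep_order M w) p) = \sum_(j < size w) G j.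
Proof.
move=> le_wM.
rewrite -(big_mkord xpredT (fun p => G (nth 0%N (sweep_order M w) p))).
rewrite -{1}(size_sweep_order le_wM).
rewrite -(big_nth 0%N xpredT) (perm_big _ (perm_sweep_order le_wM)).
by rewrite -(big_mkord xpredT) /index_iota subn0.
Qed.

(** * Residual levels of two words with the same sweep *)

Lemma level0 (w : seq int) : level w 0 = w`_0.
Proof. by rewrite /level big_ord_recl big_ord0 addr0. Qed.

Lemma levelS (w : seq int) (j : nat) : level w j.+1 = level w j + w`_j.+1.
Proof. by rewrite /level big_ord_recr. Qed.

(** The sum telescopes, the tail of a step being the head of the previous one. Only the end point
    remains, which permuting the letters preserves: this gives the balance in [walk_le]. *)
Lemma sum_mod_level (m : nat) (w : seq int) (k : int) :
  \sum_(j < size w) ((((level w j %% m)%Z - k) %% m)%Z -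
                     (((level w j %% m)%Z - w`_j - k) %% m)%Z) =
  ((\sum_(x <- w) x - k) %% m)%Z - ((- k) %% m)%Z.
Proof.
pose prefix j := \sum_(i < j) w`_i.
have levelE j : level w j = prefix j + w`_j by rewrite /level big_ord_recr.
rewrite (eq_bigr (fun j : 'I_(size w) =>
  ((prefix j.+1 - k) %% m)%Z - ((prefix j - k) %% m)%Z)) => [|j _].
  rewrite -(big_mkord xpredT (fun j =>
    ((prefix j.+1 - k) %% m)%Z - ((prefix j - k) %% m)%Z)).
  rewrite (telescope_sumr (fun j => ((prefix j - k) %% m)%Z)) //.
  by rewrite /prefix big_ord0 sub0r [in RHS](big_nth 0) big_mkord.
rewrite -[_ - w`_j - k]addrA !modzDml -/(level w j).
by rewrite {2}levelE; congr (_ - (_ %% _)%Z); lia.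
Qed.

(** An instance of [walk_le] with residual levels, time being the position in [w]. *)
Lemma sweep_level_le (M : nat) (w w' : seq int) (p : nat) :
    (level_bound w <= M)%N -> (level_bound w' <= M)%N ->
    sweep_upto M w = sweep_upto M w' -> (p < size w)%N ->
  (level w (nth 0%N (sweep_order M w) p) %% M.*2.+1)%Z <=
  (level w' (nth 0%N (sweep_order M w') p) %% M.*2.+1)%Z.
Proof.
set m := M.*2.+1; move=> le_wM le_w'M eq_sweep lt_pw.
have perm_ww' : perm_eq w w'.
  apply: (@perm_trans _ (sweep_upto M w)); first by rewrite perm_sym perm_sweep_upto.
  by rewrite eq_sweep perm_sweep_upto.
have eq_size := perm_size perm_ww'.
pose o := sweep_order M w; pose o' := sweep_order M w'.
have size_o : size o = size w by apply: size_sweep_order.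
have size_o' : size o' = size w by rewrite eq_size; apply: size_sweep_order.
have letterE (q : 'I_(size w)) : w`_(nth 0%N o q) = w'`_(nth 0%N o' q).
  rewrite -!(nth_map 0%N 0 (fun j => _`_j)) ?size_o ?size_o' //.
  by rewrite -!sweep_upto_order eq_sweep.
have anti v (le_vM : (level_bound v <= M)%N) (i j : nat) :
    (i <= j < size v)%N ->
    (level v (nth 0%N (sweep_order M v) j) %% m)%Z <=
    (level v (nth 0%N (sweep_order M v) i) %% m)%Z.
  move=> /andP[]; rewrite leq_eqVlt => /predU1P[-> // | lt_ij] lt_jv.
  have /(pairwiseP 0%N)/(_ i j) := pairwise_sweep_order M v.
  rewrite !inE size_sweep_order // => /(_ (ltn_trans lt_ij lt_jv) lt_jv lt_ij).
  by case/orP => [/ltW // | /andP[/eqP -> _]].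
have mod_window (x : int) : 0 <= (x %% m)%Z < m%:Z.
  by rewrite modz_ge0 // ltz_pmod.
pose N := size w.
apply: (@walk_le m N (fun q => w`_(nth 0%N o q))
  (fun q => (level w (nth 0%N o q) %% m)%Z)
  (fun q => (level w' (nth 0%N o' q) %% m)%Z)
  (fun q => nth 0%N o q) _ _ _ _ _ _ _ _ (Ordinal lt_pw)) => //=.
- by move=> i j le_ij; apply: anti => //; rewrite le_ij ltn_ord.
- by move=> i j le_ij; apply: anti => //; rewrite le_ij -eq_size ltn_ord.
- move=> k; pose G v j := (((level v j %% m)%Z - k) %% m)%Z -
                     (((level v j %% m)%Z - v`_j - k) %% m)%Z.
  rewrite (sum_nth_sweep_order (G w)) // sum_mod_level (perm_big _ perm_ww') /=.
  rewrite -sum_mod_level -(sum_nth_sweep_order (G w') le_w'M) -eq_size.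
  by apply: eq_bigr => q _; rewrite letterE.
- move=> i j lt_ij eq_lvl.
  have /(pairwiseP 0%N)/(_ i j) := pairwise_sweep_order M w.
  rewrite !inE size_sweep_order // => /(_ (ltn_ord _) (ltn_ord _) lt_ij).
  by rewrite eq_lvl ltxx => /andP[].
move=> q; rewrite modzDml.
(* Position 0 has tail 0; the tail at [j.+1] is the head at [j]. *)
case j_q: (nth 0%N o q) => [|j]; first by left; rewrite level0 subrr mod0z.
right; rewrite levelS addrK.
have j_o : j \in o.
  rewrite (perm_mem (perm_sweep_order le_wM)) mem_iota /= add0n ltnW //.
  have : nth 0%N o q \in o by rewrite mem_nth // size_o.
  by rewrite (perm_mem (perm_sweep_order le_wM)) mem_iota j_q.
have lt_iN : (index j o < N)%N by rewrite /N -size_o index_mem.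
by exists (Ordinal lt_iN); rewrite /= nth_index.
Qed.

(** * Recovering a word from its letters at each level *)

Lemma letters_at_level_nil (M : nat) (w : seq int) (k : int) :
  (level_bound w <= M)%N -> (M < `|k|)%N -> letters_at_level w k = [::].
Proof.
move=> le_wM lt_Mk; rewrite /letters_at_level (@eq_in_filter _ _ pred0).
  by rewrite filter_pred0.
move=> j; rewrite mem_rev mem_iota /= add0n => /level_le_bound lvl_j.
by apply/eqP => lvl; move: lvl_j; rewrite lvl; lia.
Qed.

(** Integers in [-M, M] that are congruent modulo 2M+1 are equal, so residues count levels. *)
Lemma size_letters_at_level (M : nat) (w : seq int) (k : int) :
    (level_bound w <= M)%N -> (`|k| <= M)%N ->
  size (letters_at_level w k) =
  count_mem (k %% M.*2.+1)%Z
    [seq (level w j %% M.*2.+1)%Z | j <- sweep_order M w].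
Proof.
move=> le_wM le_kM; rewrite size_map size_filter count_rev.
rewrite -(permP (perm_sweep_order le_wM)) count_map.
apply: eq_in_count => j.
rewrite (perm_mem (perm_sweep_order le_wM)) mem_iota /= add0n.
move=> /level_le_bound lvl_j; rewrite eqz_mod_dvd.
apply/eqP/dvdzP => [-> | [q]]; first by exists 0; lia.
by case: (ltrgt0P q) => q0; nia.
Qed.

(** Equal residual levels give blocks of equal lengths, and these lengths determine how the common
    sweep splits. *)
Lemma eq_letters_at_level (M : nat) (w w' : seq int) :
    (level_bound w <= M)%N -> (level_bound w' <= M)%N ->
    sweep_upto M w = sweep_upto M w' ->
  letters_at_level w =1 letters_at_level w'.
Proof.
move=> le_wM le_w'M eq_sweep k.
case: (leqP `|k| M) => [le_kM | lt_Mk]; last first.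
  by rewrite !(@letters_at_level_nil M).
have eq_size : size w = size w'.
  rewrite -(perm_size (perm_sweep_upto le_wM)) eq_sweep.
  exact: perm_size (perm_sweep_upto le_w'M).
have eq_levels : [seq (level w j %% M.*2.+1)%Z | j <- sweep_order M w] =
                 [seq (level w' j %% M.*2.+1)%Z | j <- sweep_order M w'].
  apply: (@eq_from_nth _ 0); rewrite ?size_map !size_sweep_order // => p lt_p.
  rewrite !(nth_map 0%N) ?size_sweep_order -?eq_size //.
  by apply/eqP; rewrite eq_le !sweep_level_le // -eq_size.
have eq_shape : shape [seq letters_at_level w l | l <- scan_order M] =
                shape [seq letters_at_level w' l | l <- scan_order M].
  rewrite /shape -!map_comp; apply/eq_in_map => l; rewrite mem_scan_order => le_lM.
  by rewrite /= !(@size_letters_at_level M) // eq_levels.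
have /eq_in_map := eq_from_flatten_shape eq_sweep eq_shape.
by apply; rewrite mem_scan_order.
Qed.

Lemma letters_at_level_rcons (w : seq int) (x k : int) :
  letters_at_level (rcons w x) k =
  if \sum_(y <- w) y + x == k then x :: letters_at_level w k
  else letters_at_level w k.
Proof.
have level_last : level (rcons w x) (size w) = \sum_(y <- w) y + x.
  by rewrite -[x in RHS](big_seq1 +%R _ id) -big_cat cats1 (big_nth 0)
             size_rcons big_mkord.
have eq_init : [seq (rcons w x)`_j | j <- rev (iota 0 (size w)) &
                                     level (rcons w x) j == k] =
               letters_at_level w k.
  rewrite /letters_at_level (@eq_in_filter _ _ (fun j => level w j == k)).
    apply/eq_in_map => j; rewrite mem_filter mem_rev mem_iota => /andP[_ lt_jw].
    by rewrite nth_rcons ifT.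
  move=> j; rewrite mem_rev mem_iota => lt_jw; congr (_ == k).
  apply: eq_bigr => i _; rewrite nth_rcons ifT //.
  exact: leq_trans (ltn_ord i) lt_jw.
rewrite -eq_init {1}/letters_at_level size_rcons -addn1 iotaD rev_cat /=.
by rewrite level_last; case: ifP => //= _; rewrite nth_rcons ltnn eqxx.
Qed.

(** The last letter has the total sum as its level and heads the list there; remove it and
    recurse. *)
Lemma letters_at_level_inj (w w' : seq int) :
    \sum_(x <- w) x = \sum_(x <- w') x ->
    letters_at_level w =1 letters_at_level w' ->
  w = w'.
Proof.
elim/last_ind: w w' => [|w x IHw] w'; case/lastP: w' => [|w' x'] //.
- move=> _ /(_ (\sum_(y <- w') y + x')).
  by rewrite letters_at_level_rcons eqxx.
- move=> _ /(_ (\sum_(y <- w) y + x)).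
  by rewrite letters_at_level_rcons eqxx.
rewrite !big_rcons /= => sum_eq letters_eq.
have := letters_eq (\sum_(y <- w) y + x).
rewrite !letters_at_level_rcons -sum_eq eqxx => -[eq_x _].
subst x'; congr (rcons _ x); apply: IHw => [|k]; first exact: addIr sum_eq.
have := letters_eq k; rewrite !letters_at_level_rcons -sum_eq.
by case: ifP => // _ [].
Qed.

(** * From injectivity to bijectivity *)

Lemma perm_sweep (w : seq int) : perm_eq (sweep w) w.
Proof. exact: perm_sweep_upto. Qed.

Lemma sweep_inj : injective sweep.
Proof.
move=> w w' eq_sweep.
have perm_ww' : perm_eq w w'.
  apply: (@perm_trans _ (sweep w)); first by rewrite perm_sym perm_sweep.
  by rewrite eq_sweep perm_sweep.
(* Permuted words share their bound, so one truncation serves both. *)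
have eq_bound : level_bound w' = level_bound w.
  by rewrite /level_bound (perm_big _ perm_ww').
apply: letters_at_level_inj; first exact: perm_big.
by apply: (@eq_letters_at_level (level_bound w)); rewrite ?eq_bound //;
   rewrite -{2}eq_bound.
Qed.

(** Hence [words a e] is empty or one permutation class: counts are prescribed on [codom a] and zero
    elsewhere. *)
Lemma words_perm_eq (n : nat) (a : 'I_n -> int) (e : 'I_n -> nat)
    (w w' : seq int) :
  words a e w -> perm_eq w w' <-> words a e w'.
Proof.
move=> [count_w sub_w]; split=> [perm_ww' | [count_w' sub_w']].
  split=> [j | x]; first by rewrite -(permP perm_ww').
  by rewrite -(perm_mem perm_ww') => /sub_w.
apply/allP => x _ /=; apply/eqP.
case: (boolP (x \in codom a)) => [/codomP[j ->] | x_a].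
  by rewrite count_w count_w'.
have count0 v : {subset v <= codom a} -> count_mem x v = 0%N.
  by move=> sub_v; apply/count_memPn; apply: contra x_a; apply: sub_v.
by rewrite !count0.
Qed.

Theorem theorem6p1 (n : nat) (a : 'I_n -> int) (e : 'I_n -> nat) :
  set_bij (words a e) (words a e) sweep.
Proof.
split=> [w w_words | w w' _ _ | u u_words].
- by apply/(words_perm_eq _ w_words); rewrite perm_sym perm_sweep.
- exact: sweep_inj.
(* Surjectivity: an injective self-map of the finite set of permutations of [u] is onto. *)
have sweep_perms : {subset map sweep (permutations u) <= permutations u}.
  move=> _ /mapP[w + ->]; rewrite !mem_permutations.
  exact: perm_trans (perm_sweep w).
have sweeps_uniq : uniq (map sweep (permutations u)).
  by rewrite (map_inj_uniq sweep_inj) permutations_uniq.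
have [_ perms_sweep] : (size (map sweep (permutations u)) = size (permutations u)) *
   (map sweep (permutations u) =i permutations u).
  by apply: uniq_min_size; rewrite ?size_map.
have : u \in map sweep (permutations u).
  by rewrite perms_sweep mem_permutations.
case/mapP => w; rewrite mem_permutations perm_sym => u_w ->.
by exists w => //; apply/(words_perm_eq _ u_words).
Qed.
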